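(* Let $K$ be a field of characteristic not equal to $2$. The category of $\mu$-algebras over $K$ is equivalent to the category of Ronco algebras over $K$, and under this equivalence symmetric $\mu$-algebras correspond to symmetric Leibniz algebras.
   Context: All vector spaces and tensor products are over $K$. A Leibniz algebra is a vector space $\mathcal{L}$ with a bilinear operation $[-,-]$ satisfying $[x,[y,z]]=[[x,y],z]-[[x,z],y]$. It is a symmetric Leibniz algebra if it moreover satisfies the left Leibniz identity $[[x,y],z]=[x,[y,z]]-[y,[x,z]]$. A Ronco algebra is a Leibniz algebra $\mathcal{L}$ for which there exists a central extension $0\to A\to\mathcal{L}\to\mathfrak{h}\to 0$ of Leibniz algebras (a short exact sequence with $[A,\mathcal{L}]=0=[\mathcal{L},A]$) with $\mathfrak{h}$ a Lie algebra; every symmetric Leibniz algebra is a Ronco algebra. A $\mu$-algebra is a vector space $\mathfrak{m}$ equipped with two bilinear operations $\mu:\mathfrak{m}\otimes\mathfrak{m}\to\mathfrak{m}$, written $xy=\mu(x\otimes y)$, and $\{-,-\}:\mathfrak{m}\otimes\mathfrak{m}\to\mathfrak{m}$, such that for all $x,y,z\in\mathfrak m$: (i) $xy=yx$; (ii) $x(yz)=0=(xy)z$; (iii) $\{x,x\}=0$ (hence $\{x,y\}+\{y,x\}=0$); (iv) $\{xy,z\}=0$; (v) $\{x,\{y,z\}\}+\{z,\{x,y\}\}+\{y,\{z,x\}\}=x\{y,z\}$. A $\mu$-algebra is symmetric if $x\{y,z\}=0$ for all $x,y,z$. Morphisms in these categories are the linear maps preserving the operations. The equivalence referred to is the one in which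 a Ronco bracket and the $\mu$-algebra operations on the same vector space are related by $[x,y]=\{x,y\}+xy$, $2\{x,y\}=[x,y]-[y,x]$, $2xy=[x,y]+[y,x]$. *)

(* Defs.v *)
(* boolp supplies functional extensionality and proof irrelevance, so that
   morphisms can be compared with Leibniz equality. *)
From HB Require Import structures.
From mathcomp Require Import all_boot all_algebra.
From mathcomp Require Import boolp.

Set Implicit Arguments.
Unset Strict Implicit.
Unset Printing Implicit Defensive.

Import GRing.Theory.
Local Open Scope ring_scope.

Record category := Category {
  obj :> Type;
  mor : obj -> obj -> Type;
  idm : forall a, mor a a;
  compm : forall a b c, mor b c -> mor a b -> mor a c;
  comp_idl : forall a b (f : mor a b), compm (idm b) f = f;
  comp_idr : forall a b (f : mor a b), compm f (idm a) = f;
  comp_assoc : forall a b c d (f : mor a b) (g : mor b c) (h : mor c d),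
    compm h (compm g f) = compm (compm h g) f }.
Arguments mor {_} _ _.
Arguments idm {_} _.
Arguments compm {_ _ _ _} _ _.

Record functor (C D : category) := Functor {
  fobj :> C -> D;
  fmap : forall a b : C, mor a b -> mor (fobj a) (fobj b);
  fmap_id : forall a : C, fmap (idm a) = idm (fobj a);
  fmap_comp : forall (a b c : C) (f : mor a b) (g : mor b c),
    fmap (compm g f) = compm (fmap g) (fmap f) }.
Arguments fmap {_ _} _ {_ _} _.

Program Definition functor_id (C : category) : functor C C :=
  @Functor C C id (fun _ _ => id) _ _.

Program Definition functor_comp (C D E : category)
    (G : functor D E) (F : functor C D) : functor C E :=
  @Functor C E (fun a => G (F a)) (fun _ _ f => fmap G (fmap F f)) _ _.
Next Obligation. by rewrite !fmap_id. Qed.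
Next Obligation. by rewrite !fmap_comp. Qed.

Record natural_iso (C D : category) (F G : functor C D) := NaturalIso {
  component : forall a : C, mor (F a) (G a);
  inv_component : forall a : C, mor (G a) (F a);
  component_invl : forall a, compm (inv_component a) (component a) = idm (F a);
  component_invr : forall a, compm (component a) (inv_component a) = idm (G a);
  component_natural : forall (a b : C) (f : mor a b),
    compm (component b) (fmap F f) = compm (fmap G f) (component a) }.

Record equivalence (C D : category) := Equivalence {
  eqv_to : functor C D;
  eqv_from : functor D C;
  eqv_unit : natural_iso (functor_id C) (functor_comp eqv_from eqv_to);
  eqv_counit : natural_iso (functor_comp eqv_to eqv_from) (functor_id D) }.

Program Definition full_subcategory (C : category) (P : C -> Prop) : category :=
  @Category {a : C | P a} (fun a b => mor (sval a) (sval b))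
    (fun a => idm (sval a)) (fun _ _ _ g f => compm g f) _ _ _.
Next Obligation. exact: comp_idl. Qed.
Next Obligation. exact: comp_idr. Qed.
Next Obligation. exact: comp_assoc. Qed.

(* [same_map f g]: f and g have the same domain and codomain and are equal;
   the types of f and g need only be propositionally equal. *)
Inductive same_map (A B : Type) (f : A -> B) :
    forall A' B' : Type, (A' -> B') -> Prop :=
  SameMap : same_map f f.

Lemma linear_ext (K : fieldType) (U V : lmodType K) (f g : {linear U -> V}) :
  f =1 g -> f = g.
Proof.
case: f g => [f [[f1] [f2]]] [g [[g1] [g2]]] /= /funext fg.
by case: _ / fg in g1 g2 *; rewrite (Prop_irrelevance f1 g1) (Prop_irrelevance f2 g2).
Qed.

Record leibniz_structure (K : fieldType) (V : lmodType K) := LeibnizStructure {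
  lbr : {bilinear V -> V -> V};
  lbr_leibniz : forall x y z,
    lbr x (lbr y z) = lbr (lbr x y) z - lbr (lbr x z) y }.

Record leibniz_algebra (K : fieldType) := LeibnizAlgebra {
  lcarrier :> lmodType K;
  lstructure : leibniz_structure lcarrier }.

Definition bracket (K : fieldType) (L : leibniz_algebra K) (x y : L) : L :=
  lbr (lstructure L) x y.

Record leibniz_hom (K : fieldType) (L M : leibniz_algebra K) := LeibnizHom {
  lmap :> {linear L -> M};
  lmap_bracket : forall x y, lmap (bracket x y) = bracket (lmap x) (lmap y) }.

Lemma leibniz_hom_ext (K : fieldType) (L M : leibniz_algebra K)
  (f g : leibniz_hom L M) : f =1 g -> f = g.
Proof.
case: f g => [f fP] [g gP] /= /linear_ext fg.
by case: _ / fg in gP *; rewrite (Prop_irrelevance fP gP).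
Qed.

Definition leibniz_id (K : fieldType) (L : leibniz_algebra K) :
  leibniz_hom L L.
Proof. by exists (idfun : {linear L -> L}). Defined.

Definition leibniz_comp (K : fieldType) (L M N : leibniz_algebra K)
  (g : leibniz_hom M N) (f : leibniz_hom L M) : leibniz_hom L N.
Proof.
exists (lmap g \o lmap f : {linear L -> N}).
by move=> x y /=; rewrite !lmap_bracket.
Defined.

Program Definition leibniz_category (K : fieldType) : category :=
  @Category (leibniz_algebra K) (@leibniz_hom K)
    (@leibniz_id K) (@leibniz_comp K) _ _ _.
Next Obligation. exact: leibniz_hom_ext. Qed.
Next Obligation. exact: leibniz_hom_ext. Qed.
Next Obligation. exact: leibniz_hom_ext. Qed.

Definition symmetric_leibniz (K : fieldType) (L : leibniz_algebra K) : Prop :=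
  forall x y z : L,
    bracket (bracket x y) z = bracket x (bracket y z) - bracket y (bracket x z).

Definition is_lie (K : fieldType) (L : leibniz_algebra K) : Prop :=
  (forall x : L, bracket x x = 0) /\
  (forall x y z : L, bracket x (bracket y z) + bracket y (bracket z x)
                     + bracket z (bracket x y) = 0).

Definition central_extension (K : fieldType) (A L h : leibniz_algebra K)
    (i : leibniz_hom A L) (p : leibniz_hom L h) : Prop :=
  [/\ injective i,
      (forall x : L, p x = 0 <-> exists a : A, i a = x),
      (forall y : h, exists x : L, p x = y)
    & forall (a : A) (x : L), bracket (i a) x = 0 /\ bracket x (i a) = 0].

Definition is_ronco (K : fieldType) (L : leibniz_algebra K) : Prop :=
  exists (A h : leibniz_algebra K) (i : leibniz_hom A L) (p : leibniz_hom L h),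
    central_extension i p /\ is_lie h.

Definition ronco_category (K : fieldType) : category :=
  @full_subcategory (leibniz_category K) (@is_ronco K).

Record mu_structure (K : fieldType) (V : lmodType K) := MuStructure {
  smul : {bilinear V -> V -> V};
  sbrace : {bilinear V -> V -> V};
  smulC : forall x y, smul x y = smul y x;
  smul_nil : forall x y z, smul x (smul y z) = 0 /\ smul (smul x y) z = 0;
  sbrace_alt : forall x, sbrace x x = 0;
  sbrace_mul : forall x y z, sbrace (smul x y) z = 0;
  sbrace_jacobi : forall x y z,
    sbrace x (sbrace y z) + sbrace z (sbrace x y) + sbrace y (sbrace z x)
    = smul x (sbrace y z) }.

Record mu_algebra (K : fieldType) := MuAlgebra {
  mcarrier :> lmodType K;
  mstructure : mu_structure mcarrier }.

Definition mul (K : fieldType) (m : mu_algebra K) (x y : m) : m :=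
  smul (mstructure m) x y.

Definition brace (K : fieldType) (m : mu_algebra K) (x y : m) : m :=
  sbrace (mstructure m) x y.

Record mu_hom (K : fieldType) (m n : mu_algebra K) := MuHom {
  mmap :> {linear m -> n};
  mmap_mul : forall x y, mmap (mul x y) = mul (mmap x) (mmap y);
  mmap_brace : forall x y, mmap (brace x y) = brace (mmap x) (mmap y) }.

Lemma mu_hom_ext (K : fieldType) (m n : mu_algebra K) (f g : mu_hom m n) :
  f =1 g -> f = g.
Proof.
case: f g => [f f1 f2] [g g1 g2] /= /linear_ext fg.
by case: _ / fg in g1 g2 *; rewrite (Prop_irrelevance f1 g1) (Prop_irrelevance f2 g2).
Qed.

Definition mu_id (K : fieldType) (m : mu_algebra K) : mu_hom m m.
Proof. by exists (idfun : {linear m -> m}). Defined.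

Definition mu_comp (K : fieldType) (m n p : mu_algebra K)
  (g : mu_hom n p) (f : mu_hom m n) : mu_hom m p.
Proof.
exists (mmap g \o mmap f : {linear m -> p}) => x y /=.
  by rewrite !mmap_mul.
by rewrite !mmap_brace.
Defined.

Program Definition mu_category (K : fieldType) : category :=
  @Category (mu_algebra K) (@mu_hom K) (@mu_id K) (@mu_comp K) _ _ _.
Next Obligation. exact: mu_hom_ext. Qed.
Next Obligation. exact: mu_hom_ext. Qed.
Next Obligation. exact: mu_hom_ext. Qed.

Definition symmetric_mu (K : fieldType) (m : mu_algebra K) : Prop :=
  forall x y z : m, mul x (brace y z) = 0.

(* [mu_leibniz_related m L]: m and L have the same underlying vector space V,
   and their operations on V determine each other. *)
Inductive mu_leibniz_related (K : fieldType) :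
    mu_algebra K -> leibniz_algebra K -> Prop :=
  MuLeibnizRelated (V : lmodType K)
    (s : mu_structure V) (b : leibniz_structure V) of
    (forall x y : V, lbr b x y = sbrace s x y + smul s x y) &
    (forall x y : V, 2 *: sbrace s x y = lbr b x y - lbr b y x) &
    (forall x y : V, 2 *: smul s x y = lbr b x y + lbr b y x) :
    mu_leibniz_related (MuAlgebra s) (LeibnizAlgebra b).

(* Main.v *)
(* Write [x, y] = {x, y} + xy with {-,-} alternating and the product symmetric.
   If products are annihilated by both operations, the Leibniz identity reads
     J(x, y, z) = y{z, x} + z{x, y} - x{y, z},
   where J is the Jacobi sum of the brace. As J is invariant under cyclic
   permutations, so is the right-hand side; adding two of its three forms gives
   2 J = 2 x{y, z}, so the identity is equivalent to J(x, y, z) = x{y, z}. The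
   left Leibniz identity then amounts to 2 x{y, z} = 0. On the other side, a
   Leibniz algebra L is Ronco iff all squares [x, x] are central (equivalently,
   left annihilators): they vanish in any Lie quotient, and conversely L modulo
   its center is a Lie algebra once the squares are central. *)
From HB Require Import structures.
Require Import Defs.
From mathcomp Require Import all_boot all_algebra.
From mathcomp Require Import boolp.

Set Implicit Arguments.
Unset Strict Implicit.
Unset Printing Implicit Defensive.

Import GRing.Theory.
Local Open Scope ring_scope.
Local Open Scope quotient_scope.

Definition bilinear_of (K : fieldType) (V : lmodType K) (f : V -> V -> V)
    (fP : bilinear_for *:%R *:%R f) : {bilinear V -> V -> V} :=
  HB.pack f (bilinear_isBilinear.Build K V V V *:%R *:%R f fP).

(** * Submodules and quotient modules *)

Section Submodule.
Variables (K : fieldType) (V : lmodType K) (S : submodClosed V).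

Definition submodule := {x : V | x \in S}.
HB.instance Definition _ := SubChoice.on submodule.
HB.instance Definition _ := [SubChoice_isSubLmodule of submodule by <:].

Definition zmod_closed_of : zmodClosed V :=
  HB.pack_for (zmodClosed V) (fun x => x \in S)
    (GRing.isZmodClosed.Build V (fun x => x \in S)
       (GRing.submod_closedB (submodClosedP S))).

(** At first only the additive quotient by [S]; a separate name for it lets the scalar action on
    representatives be attached below. *)
Definition quotient := Quotient.quot zmod_closed_of.
HB.instance Definition _ := GRing.Zmodule.on quotient.
Definition proj (x : V) : quotient := \pi_(Quotient.quot zmod_closed_of) x.
Definition rep (x : quotient) : V := repr (x : Quotient.quot zmod_closed_of).

Lemma proj_is_zmod_morphism : zmod_morphism proj.
Proof. exact: pi_is_zmod_morphism. Qed.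
HB.instance Definition _ :=
  GRing.isZmodMorphism.Build V quotient proj proj_is_zmod_morphism.

Lemma proj_eqP x y : proj x = proj y <-> x - y \in S.
Proof.
have -> : (x - y \in S) = (x - y \in zmod_closed_of) by [].
by rewrite Quotient.idealrBE; split=> /eqP.
Qed.

Lemma repK : cancel rep proj.
Proof. exact: reprK. Qed.

Lemma proj_surj x : exists v, proj v = x.
Proof. by exists (rep x); exact: repK. Qed.

Lemma rep_proj x : rep (proj x) - x \in S.
Proof. by apply/proj_eqP; rewrite repK. Qed.

Definition quotient_scale (a : K) (x : quotient) : quotient := proj (a *: rep x).

Lemma quotient_scale_proj a x : quotient_scale a (proj x) = proj (a *: x).
Proof. by apply/proj_eqP; rewrite -scalerBr rpredZ ?rep_proj. Qed.

Lemma quotient_scalerA a b x :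
  quotient_scale a (quotient_scale b x) = quotient_scale (a * b) x.
Proof. by rewrite -[x]repK !quotient_scale_proj scalerA. Qed.

Lemma quotient_scale1r : left_id 1 quotient_scale.
Proof. by move=> x; rewrite -[x]repK quotient_scale_proj scale1r. Qed.

Lemma quotient_scalerDr : right_distributive quotient_scale +%R.
Proof.
move=> a x y; case: (proj_surj x) (proj_surj y) => {}x <- [{}y <-].
rewrite -raddfD !quotient_scale_proj.
by rewrite scalerDr raddfD.
Qed.

Lemma quotient_scalerDl x : {morph quotient_scale^~ x : a b / a + b}.
Proof. by move=> a b; rewrite /quotient_scale scalerDl raddfD. Qed.

HB.instance Definition _ := GRing.Zmodule_isLmodule.Build K quotient
  quotient_scalerA quotient_scale1r quotient_scalerDr quotient_scalerDl.

Lemma proj_is_scalable : scalable proj.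
Proof. by move=> a x; rewrite -quotient_scale_proj. Qed.
HB.instance Definition _ :=
  GRing.isScalable.Build K V quotient *:%R proj proj_is_scalable.

End Submodule.

(** * Alternating brackets *)

Lemma alternating_anti (K : fieldType) (V : lmodType K)
    (f : {bilinear V -> V -> V}) :
  (forall x, f x x = 0) -> forall x y, f x y = - f y x.
Proof.
move=> alt x y; apply/eqP; rewrite -addr_eq0.
by have := alt (x + y); rewrite linearDl !linearDr /= !alt add0r addr0 => ->.
Qed.

(** Antisymmetry turns the two terms on the right of the Leibniz identity into the two missing terms
    of the Jacobi sum, up to sign. *)
Lemma alternating_lie (K : fieldType) (L : leibniz_algebra K) :
  (forall x : L, bracket x x = 0) -> is_lie L.
Proof.
move=> alt; split=> // x y z; have anti := @alternating_anti _ _ _ alt.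
rewrite /bracket lbr_leibniz (anti (lbr _ x y) z) (anti (lbr _ x z) y).
by rewrite (anti x z) linearNr /= opprK subrK addNr.
Qed.

(** * The center and the criterion for Ronco algebras *)

Section Center.
Variables (K : fieldType) (L : leibniz_algebra K).

Lemma bracket_bilinear : bilinear_for *:%R *:%R (@bracket K L).
Proof.
by split=> x a y z; rewrite /bracket ?linearPl ?linearPr.
Qed.

Lemma leibnizE (x y z : L) :
  bracket x (bracket y z) = bracket (bracket x y) z - bracket (bracket x z) y.
Proof. exact: lbr_leibniz. Qed.

(** The annihilator on both sides, made boolean by classical reflection so that it can carry a
    submodule structure. *)
Definition center : {pred L} :=
  fun x => `[< forall y : L, bracket x y = 0 /\ bracket y x = 0 >].

Lemma centerP (x : L) :
  x \in center <-> forall y : L, bracket x y = 0 /\ bracket y x = 0.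
Proof. by split=> [/asboolP|?]; last exact/asboolP. Qed.

Lemma center_submod_closed : submod_closed center.
Proof.
split=> [|a x y /centerP xZ /centerP yZ]; apply/centerP => z.
  by rewrite /bracket linear0l linear0r.
have [[xz zx] [yz zy]] := (xZ z, yZ z).
rewrite (bracket_bilinear.1 z a) (bracket_bilinear.2 z a) /=.
by rewrite xz zx yz zy scaler0 addr0.
Qed.
HB.instance Definition _ :=
  GRing.isSubmodClosed.Build K L center center_submod_closed.

Definition quotient_bracket (x y : quotient center) : quotient center :=
  proj center (bracket (rep x) (rep y)).

Lemma bracketDl (z : L) : {morph (@bracket K L)^~ z : x y / x + y}.
Proof. exact: linearDl. Qed.
Lemma bracketDr (z : L) : {morph @bracket K L z : x y / x + y}.
Proof. exact: linearDr. Qed.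
Lemma bracketBl (z : L) : {morph (@bracket K L)^~ z : x y / x - y}.
Proof. exact: linearBl. Qed.
Lemma bracketBr (z : L) : {morph @bracket K L z : x y / x - y}.
Proof. exact: linearBr. Qed.

Lemma quotient_bracket_proj x y :
  quotient_bracket (proj center x) (proj center y) = proj center (bracket x y).
Proof.
apply/proj_eqP; have /centerP xZ := rep_proj center x.
have /centerP yZ := rep_proj center y.
set x' := rep _; set y' := rep _.
(* Changing representatives alters the bracket by two terms, each with a central argument. *)
have -> : bracket x' y' - bracket x y
    = bracket (x' - x) y' + bracket x (y' - y).
  by rewrite bracketBl bracketBr addrA subrK.
by rewrite (xZ _).1 (yZ _).2 addr0 rpred0.
Qed.

Lemma quotient_bracket_bilinear : bilinear_for *:%R *:%R quotient_bracket.
Proof.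
split=> u a x y; case: (proj_surj u) (proj_surj x) (proj_surj y);
  move=> {}u <- [{}x <-] [{}y <-]; rewrite -linearP !quotient_bracket_proj.
  rewrite -linearP; congr (proj _ _); exact: bracket_bilinear.1.
rewrite -linearP; congr (proj _ _); exact: bracket_bilinear.2.
Qed.

Definition quotient_leibniz : leibniz_algebra K.
Proof.
exists (quotient center : lmodType K).
exists (bilinear_of quotient_bracket_bilinear) => x y z.
case: (proj_surj x) (proj_surj y) (proj_surj z) => {}x <- [{}y <-] [{}z <-].
rewrite /= (quotient_bracket_proj y z) (quotient_bracket_proj x y).
rewrite (quotient_bracket_proj x z) !quotient_bracket_proj -raddfB.
by rewrite leibnizE.
Defined.

Definition proj_hom : leibniz_hom L quotient_leibniz.
Proof.
exists (proj center : {linear L -> quotient center}) => x y.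
by rewrite [RHS]quotient_bracket_proj.
Defined.

(** The bracket of the center: central elements bracket to zero, so the kernel of the extension is
    abelian. *)
Lemma zero_bilinear :
  bilinear_for *:%R *:%R (fun _ _ : submodule center => 0 : submodule center).
Proof. by split=> u a x y; rewrite /= scaler0 addr0. Qed.

Definition center_leibniz : leibniz_algebra K.
Proof.
exists (submodule center : lmodType K).
exists (bilinear_of zero_bilinear) => x y z.
by rewrite /= subrr.
Defined.

Definition center_incl : leibniz_hom center_leibniz L.
Proof.
exists (\val : {linear submodule center -> L}) => x y.
have /centerP xZ := valP x.
by rewrite (xZ _).1 raddf0.
Defined.

Lemma center_extension : central_extension center_incl proj_hom.
Proof.
split=> [||y|a x].
- exact: val_inj.
- move=> x; rewrite -[0 in X in X <-> _](raddf0 (proj center)).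
  rewrite proj_eqP subr0; split=> [xZ|[a <-]]; first by exists (Sub x xZ).
  exact: valP.
- by exists (rep y); exact: repK.
- by have /centerP := valP a; apply.
Qed.

Lemma is_roncoP :
  is_ronco L <-> forall x y : L, bracket (bracket x x) y = 0.
Proof.
split=> [[A [h [i [p [[_ kerp _ central] [alt _]]]]]] x y|sqr0].
  (* The square vanishes in the Lie quotient, hence comes from the central kernel. *)
  have [|a <-] := (kerp (bracket x x)).1; first by rewrite lmap_bracket alt.
  exact: (central a y).1.
exists center_leibniz, quotient_leibniz, center_incl, proj_hom.
split; first exact: center_extension.
have alt x : bracket x x = 0 :> quotient_leibniz.
  case: (proj_surj x) => {}x <-; rewrite [LHS]quotient_bracket_proj.
  rewrite -[RHS](raddf0 (proj center)).
  apply/proj_eqP; rewrite subr0; apply/centerP => y; split=> //.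
  (* Squares annihilate from the right in every Leibniz algebra: [y, [x, x]] = [[y, x], x] -
     [[y, x], x]. *)
  by rewrite leibnizE subrr.
exact: alternating_lie.
Qed.

End Center.

(** * A bracket as the sum of an antisymmetric and a symmetric operation *)

Section Splitting.
Variables (K : fieldType) (V : lmodType K) (f a s : {bilinear V -> V -> V}).
Hypotheses (two_neq0 : 2 != 0 :> K) (fE : forall x y, f x y = a x y + s x y)
  (aN : forall x y, a x y = - a y x) (sC : forall x y, s x y = s y x)
  (ssr0 : forall x y z, s x (s y z) = 0) (asl0 : forall x y z, a (s x y) z = 0).

Definition cyclic_sum x y z := a x (a y z) + a z (a x y) + a y (a z x).

Lemma cyclic_sumC x y z : cyclic_sum y z x = cyclic_sum x y z.
Proof. by rewrite /cyclic_sum [LHS](ACl (2 * 3 * 1)). Qed.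

Lemma split_right x y z : f x (f y z) = a x (a y z) + s x (a y z).
Proof. by rewrite !fE !linearDr /= ssr0 addr0 [a x (s y z)]aN asl0 subr0. Qed.

Lemma split_left x y z : f (f x y) z = s z (a x y) - a z (a x y).
Proof.
by rewrite !fE !linearDl asl0 addr0 [s (s x y) z]sC ssr0 addr0 addrC sC -aN.
Qed.

Lemma split_leibnizP x y z :
  f x (f y z) = f (f x y) z - f (f x z) y <->
  cyclic_sum x y z = s y (a z x) + s z (a x y) - s x (a y z).
Proof.
rewrite !split_left split_right [a x z]aN !linearNr.
suff -> : (a x (a y z) + s x (a y z) =
           s z (a x y) - a z (a x y) - (- s y (a z x) - - a y (a z x))) <->
          (cyclic_sum x y z - (s y (a z x) + s z (a x y) - s x (a y z)) = 0).
  by split=> [/subr0_eq|->]; rewrite ?subrr.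
rewrite /cyclic_sum; set A := s x _; set B := s y _; set C := s z _.
set P := a x _; set Q := a z _; set R := a y _.
(* Both sides are the sum of P, Q, R, A, -B and -C in different orders. *)
have -> : P + Q + R - (B + C - A) = P + A - (C - Q - (- B - - R)).
  rewrite !opprD !opprK.
  by rewrite [RHS](AC (2 * (2 * 2)) ((1 * 4 * 6) * (5 * 3 * 2))).
by split=> [->|/subr0_eq]; rewrite ?subrr.
Qed.

(** Characteristic different from 2 enters the splitting argument here. *)
Lemma double_inj (x y : V) : x + x = y + y -> x = y.
Proof. by rewrite -!mulr2n -!scaler_nat => /(scalerI two_neq0). Qed.

Lemma leibniz_jacobiP :
  (forall x y z, f x (f y z) = f (f x y) z - f (f x z) y) <->
  (forall x y z, cyclic_sum x y z = s x (a y z)).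
Proof.
split=> [leib|jac] x y z; last first.
  apply/split_leibnizP.
  (* By [jac] and cyclic invariance all three terms on the right equal J, and J = J + J - J. *)
  by rewrite -!jac -(cyclic_sumC x) -(cyclic_sumC y) addrK.
have cyc u v w := (split_leibnizP u v w).1 (leib u v w).
(* In these two rotations [s x (a y z)] has a plus sign both times, while each of the other two
   terms changes sign and cancels in the sum. *)
have cycy : cyclic_sum x y z = s z (a x y) + s x (a y z) - s y (a z x).
  by rewrite -cyclic_sumC cyc.
have cycz : cyclic_sum x y z = s x (a y z) + s y (a z x) - s z (a x y).
  by rewrite (cyclic_sumC z) cyc.
apply: double_inj; rewrite {1}cycy cycz.
rewrite [LHS](AC (3 * 3) ((2 * 4) * ((3 * 5) * (1 * 6)))) /=.
by rewrite addNr subrr !addr0.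
Qed.

Lemma left_leibnizP :
  (forall x y z, cyclic_sum x y z = s x (a y z)) ->
  (forall x y z, f (f x y) z = f x (f y z) - f y (f x z)) <->
  (forall x y z, s x (a y z) = 0).
Proof.
move=> jac.
(* With A, B, C the rotations of [s x (a y z)], the defect of the left identity is J + A + B - C; by
   [jac] all of these equal J, which leaves 2A. *)
have diff x y z : f x (f y z) - f y (f x z) - f (f x y) z
    = s x (a y z) + s x (a y z).
  have EB : s y (a z x) = s x (a y z) by rewrite -!jac cyclic_sumC.
  have EC : s z (a x y) = s x (a y z) by rewrite -EB -!jac cyclic_sumC.
  rewrite !split_right split_left [a x z]aN !linearNr EB EC.
  rewrite !opprD !opprK [LHS](AC (2 * 2 * 2) ((1 * 6 * 3) * 2 * (5 * 4))) /=.
  by rewrite addNr addr0 -[X in _ = X + _]jac.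
split=> [left|sa0] x y z.
  by apply: double_inj; rewrite -diff left subrr addr0.
by apply/esym/subr0_eq; rewrite diff sa0 addr0.
Qed.

End Splitting.

Lemma two_neq0 (K : fieldType) : 2%N \notin [pchar K] -> 2 != 0 :> K.
Proof. by rewrite inE /=. Qed.

(** * From mu-algebras to Ronco algebras *)

Section MuToRonco.
Variables (K : fieldType) (two_neq0 : 2 != 0 :> K).

Section MuStructure.
Variables (V : lmodType K) (m : mu_structure V).

Definition mu_bracket (x y : V) : V := sbrace m x y + smul m x y.

Lemma mu_bracket_bilinear : bilinear_for *:%R *:%R mu_bracket.
Proof.
by split=> u a x y; rewrite /mu_bracket ?linearPl ?linearPr /= scalerDr addrACA.
Qed.

Let f := bilinear_of mu_bracket_bilinear.

Lemma mu_bracketE x y : f x y = sbrace m x y + smul m x y.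
Proof. by []. Qed.

Lemma sbrace_anti x y : sbrace m x y = - sbrace m y x.
Proof. exact/alternating_anti/sbrace_alt. Qed.

Lemma mu_leibniz x y z : f x (f y z) = f (f x y) z - f (f x z) y.
Proof.
move: x y z; apply/(leibniz_jacobiP two_neq0 mu_bracketE sbrace_anti (smulC m)).
- by move=> x y z; have [] := smul_nil m x y z.
- exact: sbrace_mul.
- exact: sbrace_jacobi.
Qed.

Definition leibniz_of_mu_structure : leibniz_structure V :=
  LeibnizStructure mu_leibniz.

End MuStructure.

Definition leibniz_of_mu (m : mu_algebra K) : leibniz_algebra K :=
  LeibnizAlgebra (leibniz_of_mu_structure (mstructure m)).

(** Since {x, x} = 0, the square [x, x] is the product xx, and both operations vanish on it. *)
Lemma leibniz_of_mu_ronco m : is_ronco (leibniz_of_mu m).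
Proof.
apply/is_roncoP => x y; rewrite /bracket /= /mu_bracket.
by rewrite sbrace_alt add0r sbrace_mul add0r (smul_nil _ _ _ _).2.
Qed.

Definition ronco_of_mu (m : mu_category K) : ronco_category K :=
  exist _ (leibniz_of_mu m) (leibniz_of_mu_ronco m).

Definition ronco_hom_of_mu (m n : mu_category K) (f : mor m n) :
  mor (ronco_of_mu m) (ronco_of_mu n).
Proof.
exists (mmap f : {linear m -> n}) => x y; rewrite raddfD.
by congr (_ + _); [exact: mmap_brace | exact: mmap_mul].
Defined.

Definition mu_to_ronco : functor (mu_category K) (ronco_category K).
Proof.
by exists ronco_of_mu ronco_hom_of_mu => *; apply: leibniz_hom_ext.
Defined.

End MuToRonco.

(** * From Ronco algebras to mu-algebras *)

Section RoncoToMu.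
Variables (K : fieldType) (two_neq0 : 2 != 0 :> K).

Lemma half_double (V : lmodType K) (x : V) : 2^-1 *: (x + x) = x.
Proof. by rewrite -mulr2n -scaler_nat scalerA mulVf ?scale1r. Qed.

Lemma two_half (V : lmodType K) (x : V) : 2 *: (2^-1 *: x) = x.
Proof. by rewrite scalerA divff ?scale1r. Qed.

Section Leibniz.
Variables (L : leibniz_algebra K) (ronco : is_ronco L).

Definition half_sum (x y : L) : L := 2^-1 *: (bracket x y + bracket y x).
Definition half_diff (x y : L) : L := 2^-1 *: (bracket x y - bracket y x).

Lemma half_sum_bilinear : bilinear_for *:%R *:%R half_sum.
Proof.
split=> u a x y; rewrite /half_sum /bracket linearPl linearPr /=.
  by rewrite addrACA -scalerDr [LHS]scalerDr !scalerA mulrC.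
by rewrite addrACA -scalerDr [LHS]scalerDr !scalerA mulrC.
Qed.

Lemma half_diff_bilinear : bilinear_for *:%R *:%R half_diff.
Proof.
split=> u a x y; rewrite /half_diff /bracket linearPl linearPr /=.
  by rewrite opprD addrACA -scalerBr [LHS]scalerDr !scalerA mulrC.
by rewrite opprD addrACA -scalerBr [LHS]scalerDr !scalerA mulrC.
Qed.

Let s := bilinear_of half_sum_bilinear.
Let a := bilinear_of half_diff_bilinear.

Lemma bracket_split x y : lbr (lstructure L) x y = a x y + s x y.
Proof. by rewrite -scalerDr addrACA addNr addr0 half_double. Qed.

Lemma half_diff_alt x : a x x = 0.
Proof. by rewrite /= /half_diff subrr scaler0. Qed.

Lemma half_sumC x y : s x y = s y x.
Proof. by rewrite /= /half_sum addrC. Qed.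

(** On the left, polarise the vanishing of [[x, x], z] at x + y. On the right, the Leibniz
    expansions of [z, [x, y]] and [z, [y, x]] are opposite to each other. *)
Lemma half_sum_central x y z :
  bracket (half_sum x y) z = 0 /\ bracket z (half_sum x y) = 0.
Proof.
have sqr0 := (is_roncoP L).1 ronco.
split; rewrite /half_sum.
  rewrite /bracket linearZl_LR /= -!/(bracket _ _).
  have := sqr0 (x + y) z; rewrite bracketDl !bracketDr !bracketDl !sqr0.
  by rewrite add0r addr0 -bracketDl => ->; rewrite scaler0.
rewrite /bracket linearZr_LR /= -!/(bracket _ _) bracketDr !leibnizE.
by rewrite addrC subrKA subrr scaler0.
Qed.

Lemma half_sum_nil x y z : s x (s y z) = 0 /\ s (s x y) z = 0.
Proof.
split; rewrite /= {1}/half_sum.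
  by have [-> ->] := half_sum_central y z x; rewrite addr0 scaler0.
by have [-> ->] := half_sum_central x y z; rewrite addr0 scaler0.
Qed.

Lemma half_diff_sum x y z : a (s x y) z = 0.
Proof.
rewrite /= /half_diff; have [-> ->] := half_sum_central x y z.
by rewrite subr0 scaler0.
Qed.

Lemma half_jacobi x y z :
  a x (a y z) + a z (a x y) + a y (a z x) = s x (a y z).
Proof.
move: x y z; apply/(leibniz_jacobiP two_neq0 bracket_split _ half_sumC).
- exact/alternating_anti/half_diff_alt.
- by move=> x y z; case: (half_sum_nil x y z).
- exact: half_diff_sum.
- exact: lbr_leibniz.
Qed.

Definition mu_structure_of_leibniz : mu_structure L :=
  MuStructure half_sumC half_sum_nil half_diff_alt half_diff_sum half_jacobi.

End Leibniz.

Definition mu_of_ronco (L : ronco_category K) : mu_category K :=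
  MuAlgebra (mu_structure_of_leibniz (svalP L)).

Definition mu_hom_of_ronco (L M : ronco_category K) (g : mor L M) :
  mor (mu_of_ronco L) (mu_of_ronco M).
Proof.
exists (lmap g : {linear sval L -> sval M}) => x y.
  by rewrite [LHS]linearZ raddfD;
     congr (_ *: (_ + _)); exact: lmap_bracket.
by rewrite [LHS]linearZ raddfB;
     congr (_ *: (_ - _)); exact: lmap_bracket.
Defined.

Definition ronco_to_mu : functor (ronco_category K) (mu_category K).
Proof. by exists mu_of_ronco mu_hom_of_ronco => *; apply: mu_hom_ext. Defined.

End RoncoToMu.

(** * The natural isomorphisms and the equivalence *)

Section Equivalence.
Variables (K : fieldType) (charK : 2%N \notin [pchar K]).
Let nz2 := two_neq0 charK.

(** Both functors keep the carrier and the linear maps, so the components are identity maps in both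
    directions; what remains is that halving the sum and the difference of the brackets recovers the
    operations. *)
Definition mu_unit : natural_iso (functor_id (mu_category K))
  (functor_comp (ronco_to_mu nz2) (mu_to_ronco nz2)).
Proof.
pose F := functor_comp (ronco_to_mu nz2) (mu_to_ronco nz2).
have mulE (m : mu_category K) (x y : m) : Defs.mul x y = @Defs.mul K (F m) x y.
  rewrite /Defs.mul /= /half_sum /bracket /= /mu_bracket.
  rewrite [sbrace _ y x]sbrace_anti [smul _ y x]smulC addrACA subrr add0r.
  by rewrite half_double.
have braceE (m : mu_category K) (x y : m) : brace x y = @brace K (F m) x y.
  rewrite /brace /= /half_diff /bracket /= /mu_bracket.
  rewrite [sbrace _ y x]sbrace_anti [smul _ y x]smulC opprD addrACA subrr addr0.
  by rewrite opprK half_double.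
exists (fun m : mu_category K => @MuHom K m (F m) (idfun : {linear m -> m})
          (@mulE m) (@braceE m))
       (fun m : mu_category K => @MuHom K (F m) m (idfun : {linear m -> m})
          (fun x y => esym (mulE m x y)) (fun x y => esym (braceE m x y)));
  by move=> *; apply: mu_hom_ext.
Qed.

Definition ronco_counit : natural_iso
  (functor_comp (mu_to_ronco nz2) (ronco_to_mu nz2))
  (functor_id (ronco_category K)).
Proof.
pose F := functor_comp (mu_to_ronco nz2) (ronco_to_mu nz2).
have brE (L : ronco_category K) (x y : sval L) :
    @bracket K (sval (F L)) x y = bracket x y.
  by rewrite {2}/bracket (bracket_split nz2).
exists (fun L : ronco_category K => @LeibnizHom K (sval (F L)) (sval L)
          (idfun : {linear sval L -> sval L}) (@brE L))
       (fun L : ronco_category K => @LeibnizHom K (sval L) (sval (F L))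
          (idfun : {linear sval L -> sval L}) (fun x y => esym (brE L x y)));
  by move=> *; apply: leibniz_hom_ext.
Qed.

Definition mu_ronco_equivalence :
    equivalence (mu_category K) (ronco_category K) :=
  Equivalence mu_unit ronco_counit.

End Equivalence.

(** * Related structures and the symmetric case *)

(** Stated for an arbitrary related pair so that it serves both functors; axiom (v) of the
    mu-algebra supplies the Jacobi hypothesis of [left_leibnizP]. *)
Lemma related_symmetricP (K : fieldType) (m : mu_algebra K)
    (L : leibniz_algebra K) :
  2 != 0 :> K -> mu_leibniz_related m L -> symmetric_mu m <-> symmetric_leibniz L.
Proof.
move=> nz2 [V s b bE _ _]; apply: iff_sym.
apply: (left_leibnizP nz2 bE).
- exact: sbrace_anti.
- exact: smulC.
- by move=> x y z; case: (smul_nil s x y z).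
- exact: sbrace_mul.
- exact: sbrace_jacobi.
Qed.

Lemma leibniz_of_mu_related (K : fieldType) (nz2 : 2 != 0 :> K)
    (m : mu_algebra K) :
  mu_leibniz_related m (leibniz_of_mu nz2 m).
Proof.
case: m => V s; apply: MuLeibnizRelated => x y //=; rewrite /mu_bracket.
  rewrite [sbrace s y x]sbrace_anti [smul s y x]smulC opprD addrACA subrr addr0.
  by rewrite opprK scaler_nat mulr2n.
rewrite [sbrace s y x]sbrace_anti [smul s y x]smulC addrACA subrr add0r.
by rewrite scaler_nat mulr2n.
Qed.

Lemma mu_of_ronco_related (K : fieldType) (nz2 : 2 != 0 :> K)
    (L : ronco_category K) :
  mu_leibniz_related (mu_of_ronco nz2 L) (sval L).
Proof.
case: L => [[V b] ronco]; apply: MuLeibnizRelated => x y.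
- exact: (bracket_split nz2).
- exact: two_half.
- exact: two_half.
Qed.

(** The left identity with two equal arguments reads [[x, x], y] = [x, [x, y]] - [x, [x, y]] = 0. *)
Lemma symmetric_leibniz_ronco (K : fieldType) (L : leibniz_algebra K) :
  symmetric_leibniz L -> is_ronco L.
Proof. by move=> sym; apply/is_roncoP => x y; rewrite sym subrr. Qed.

Theorem theorem12 (K : fieldType) (charK : 2%N \notin [pchar K]%R) :
  exists E : equivalence (mu_category K) (ronco_category K),
    [/\ (* the equivalence keeps the vector space and relates the operations *)
        (forall m : mu_category K,
           mu_leibniz_related m (sval (eqv_to E m))),
        (forall L : ronco_category K,
           mu_leibniz_related (eqv_from E L) (sval L)),
        (* and it keeps the maps underlying the morphisms *)
        (forall (m n : mu_category K) (f : mor m n),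
           same_map (mmap f) (lmap (fmap (eqv_to E) f))),
        (forall (L M : ronco_category K) (g : mor L M),
           same_map (lmap g) (mmap (fmap (eqv_from E) g)))
      & (* symmetric mu-algebras correspond to symmetric Leibniz algebras *)
        [/\ (forall L : leibniz_algebra K, symmetric_leibniz L -> is_ronco L),
            (forall m : mu_category K,
               symmetric_mu m <-> symmetric_leibniz (sval (eqv_to E m)))
          & (forall L : ronco_category K,
               symmetric_leibniz (sval L) <-> symmetric_mu (eqv_from E L))]].
Proof.
have nz2 := two_neq0 charK.
(* The two claims on underlying maps hold by computation, as each functor reuses the given linear
   map. *)
exists (mu_ronco_equivalence charK); split=> //; last split.
- exact: leibniz_of_mu_related.
- exact: mu_of_ronco_related.
- exact: symmetric_leibniz_ronco.
- by move=> m; apply: related_symmetricP => //; exact: leibniz_of_mu_related.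
- move=> L; apply: iff_sym; apply: related_symmetricP => //.
  exact: mu_of_ronco_related.
Qed.
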